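(* Consider a stochastic positive semilinear problem with data $(X,U(\cdot),\Theta,f,g,\alpha,\widehat{\mathcal M})$ satisfying the stochastic versions of Closure and Attainability, Stabilizability, State Space Structure, and Observability (all as defined in the context). Let $J^*$ be the optimal cost function of the stochastic problem, and let $\hat J^*$ be the optimal cost function of its deterministic counterpart: minimize $\sum_{k=0}^\infty\alpha^k\hat g(x_k,u_k)$ over $\{u_k\}$ subject to $x_{k+1}=\hat f(x_k,u_k)$, $u_k\in U(x_k)$, $k=0,1,\dots$, with $x_0\in X$ given, where $\hat f(x,u)=E_\theta\{f(x,u,\theta)\}$ and $\hat g(x,u)=E_\theta\{g(x,u,\theta)\}$. Then: (a) There exists a vector $c^*\in\mathbb R^n_+$ such that $J^*(x)=\hat J^*(x)=(c^* )'x$ for all $x\in X$. Moreover, $c^*$ is the unique vector within $\mathbb R^n_+$ that satisfies $c^*=\widehat G(c^* )$. (b) A policy $\mu\in\widehat{\mathcal M}$ is optimal for the deterministic counterpart if and only if it is optimal for the stochastic problem. Moreover, there exists at least one optimal policy.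
   Context: Notation: $\mathbb R^n_+$ is the set of vectors in $\mathbb R^n$ with nonnegative components; a prime denotes transposition; $E_\theta$ denotes expectation with respect to the distribution of $\theta$. Measurability issues are not addressed. Stochastic positive semilinear problem: $X\subset\mathbb R^n_+$ is the state space; $U(x)$, $x\in X$, are nonempty control constraint sets; $\Theta$ is a parameter set. At each stage $k$ a parameter $\theta_k\in\Theta$ is generated according to a known distribution that is the same for all stages, independently of $\theta_0,\dots,\theta_{k-1}$. $\alpha\in(0,1]$ is a given scalar. For $x_0\in X$, the problem is to minimize $$\lim_{N\to\infty}E_{\theta_0,\dots,\theta_{N-1}}\Big\{\sum_{k=0}^{N-1}\alpha^kg(x_k,\mu_k(x_k),\theta_k)\Big\}$$ over sequences $\{\mu_0,\mu_1,\dots\}$ of functions on $X$ with $\mu_k(x)\in U(x)$ for all $x\in X$, subject to $x_{k+1}=f(x_k,\mu_k(x_k),\theta_k)$. $J^*(x_0)$ is the optimal cost starting from $x_0$. For all $x\in X$, $u\in U(x)$, $\theta\in\Theta$: $f(x,u,\theta)\in X$, $E_\theta\{f(x,u,\theta)\}\in X$, $g(x,u,\theta)\ge0$. A (stationary) policy is a function $\mu$ on $X$ with $\mu(x)\in U(x)$ for all $x\in X$; it is optimal for one of the problems if using $\mu$ at every stage attains that problem's optimal cost from every $x_0\in X$. $\widehat{\mathcal M}$ is a given set of policies such that for every $\mu\in\widehat{\mathcal M}$ and $\theta\in\Theta$ there exist an $n\times n$ nonnegative matrix $A_\mu^\theta$ and a vector $q_\mu^\theta\in\mathbb R^n$ with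 $f(x,\mu(x),\theta)=A_\mu^\theta x$ and $g(x,\mu(x),\theta)=(q_\mu^\theta)'x$ for all $x\in X$. $\widehat{\mathcal J}$ is the set of functions $J(x)=c'x$ on $X$ with $c\in\mathbb R^n_+$. Assumptions: Closure and Attainability: for every $c\in\mathbb R^n_+$, the function $x\mapsto\min_{u\in U(x)}E_\theta\{g(x,u,\theta)+\alpha c'f(x,u,\theta)\}$ belongs to $\widehat{\mathcal J}$, i.e., equals $\hat c'x$ for some unique $\hat c\in\mathbb R^n_+$; $\hat c$ depends continuously on $c$; and there is a policy $\mu\in\widehat{\mathcal M}$ with $\mu(x)\in\arg\min_{u\in U(x)}E_\theta\{g(x,u,\theta)+\alpha c'f(x,u,\theta)\}$ for all $x\in X$. Stabilizability: there exists $\hat\mu\in\widehat{\mathcal M}$ such that $\alpha E_\theta\{A^\theta_{\hat\mu}\}$ is stable (all its eigenvalues lie strictly within the unit circle). State Space Structure: for every $v\in\mathbb R^n_+$ there exist $x\in X$ and a scalar $s\ge0$ with $sx=v$. Observability: there exists an integer $N$ such that the optimal cost of the $N$-stage version of the problem (minimizing $E_{\theta_0,\dots,\theta_{N-1}}\{\sum_{k=0}^{N-1}\alpha^kg(x_k,u_k,\theta_k)\}$, starting from any nonzero initial state $x_0\in X$) is strictly positive. The mapping $\widehat G:\mathbb R^n_+\to\mathbb R^n_+$ is defined by letting $\widehat G(c)$ be the unique vector with $\widehat G(c)'x=\min_{u\in U(x)}E_\theta\{g(x,u,\theta)+\alpha c'f(x,u,\theta)\}$ for all $x\in X$. *)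

(* Defs.v *)
(* MathComp / MathComp-Analysis, over an arbitrary [R : realType]. *)
From HB Require Import structures.
From mathcomp Require Import all_boot all_order all_algebra.
From mathcomp Require Import complex.
From mathcomp Require Import all_classical all_reals all_analysis.

Set Implicit Arguments.
Unset Strict Implicit.
Unset Printing Implicit Defensive.

Import Order.TTheory GRing.Theory Num.Theory.
Import numFieldNormedType.Exports.

Local Open Scope classical_set_scope.
Local Open Scope ring_scope.

Section LinearAlgebra.
Context {R : realType}.

Definition nonneg_mx {m n} : set 'M[R]_(m, n) :=
  [set A | forall i j, 0 <= A i j].

Definition dotmul {n} (c x : 'cV[R]_n) : R := (c^T *m x) 0 0.

(* The eigenvalues are the complex ones, hence the embedding into R[i]. *)
Definition stable {n} (A : 'M[R]_n) : Prop :=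
  forall z : complex R,
    eigenvalue (map_mx (real_complex R) A) z -> `|z| < 1.

End LinearAlgebra.

Section ProductProbability.
Context {d : measure_display} {T : measurableType d} {R : realType}.

Definition tuple_cons N (z : T * N.-tuple T) : N.+1.-tuple T :=
  [the N.+1.-tuple T of z.1 :: z.2].

Lemma measurable_tuple_cons N : measurable_fun setT (@tuple_cons N).
Proof.
exact: (measurable_cons (measurable_fst) (measurable_snd)).
Qed.

HB.instance Definition _ N :=
  @isMeasurableFun.Build _ _ _ _ (@tuple_cons N) (@measurable_tuple_cons N).

(* The law of N independent draws from P, on the product sigma-algebra. *)
Fixpoint iid (P : probability T R) N : probability (N.-tuple T) R :=
  match N with
  | 0 => \d_([tuple] : 0.-tuple T)
  | N'.+1 => distribution (P \x iid P N')%E (@tuple_cons N')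
  end.

End ProductProbability.

(* States are column vectors, [Ctl] is an ambient type of controls. Only the
   values at x in [state_space], u in [ctrl x] matter. *)
Record problem (R : realType) (n : nat) (d : measure_display)
    (Theta : measurableType d) (Ctl : Type) := Problem {
  state_space : set 'cV[R]_n ;
  ctrl : 'cV[R]_n -> set Ctl ;
  dyn : 'cV[R]_n -> Ctl -> Theta -> 'cV[R]_n ;
  stage : 'cV[R]_n -> Ctl -> Theta -> R ;
  disc : R ;
  law : probability Theta R }.

Section SemilinearProblem.
Context {R : realType} {n : nat} {d : measure_display}.
Context {Theta : measurableType d} {Ctl : Type}.
Variable pb : problem R n Theta Ctl.

Local Notation vec := 'cV[R]_n.
Local Notation X := (state_space pb).
Local Notation U := (ctrl pb).
Local Notation f := (dyn pb).
Local Notation g := (stage pb).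
Local Notation alpha := (disc pb).
Local Notation P := (law pb).

(* Junk value 0 if the expectation is not finite; only used on integrands that
   are integrable under [well_posed] (and [linear_policies]). *)
Definition Ex (F : Theta -> R) : R := fine 'E_P[F].

Definition Ex_mx p q (F : Theta -> 'M[R]_(p, q)) : 'M[R]_(p, q) :=
  \matrix_(i, j) Ex (fun theta => F theta i j).

Definition mean_dyn (x : vec) (u : Ctl) : vec := Ex_mx (f x u).
Definition mean_stage (x : vec) (u : Ctl) : R := Ex (g x u).

(* The integrability clauses make the single-stage expectations E{f(x,u,.)}
   and E{g(x,u,.)} meaningful real quantities. *)
Record well_posed : Prop := WellPosed {
  disc_in01 : 0 < alpha <= 1 ;
  state_nonneg : X `<=` nonneg_mx ;
  ctrl_nonempty : forall x, X x -> U x !=set0 ;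
  dyn_state : forall x u theta, X x -> U x u -> X (f x u theta) ;
  dyn_integrable : forall x u, X x -> U x u ->
    forall i, P.-integrable setT (fun theta => (f x u theta i 0)%:E) ;
  mean_dyn_state : forall x u, X x -> U x u -> X (mean_dyn x u) ;
  stage_ge0 : forall x u theta, X x -> U x u -> 0 <= g x u theta ;
  stage_integrable : forall x u, X x -> U x u ->
    P.-integrable setT (fun theta => (g x u theta)%:E) }.

Definition policy (mu : vec -> Ctl) : Prop := forall x, X x -> U x (mu x).

Definition linear_policies (M : set (vec -> Ctl))
    (A : (vec -> Ctl) -> Theta -> 'M[R]_n)
    (q : (vec -> Ctl) -> Theta -> vec) : Prop :=
  forall mu, M mu -> policy mu /\
    forall theta, nonneg_mx (A mu theta) /\
      forall x, X x -> f x (mu x) theta = A mu theta *m x /\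
                       g x (mu x) theta = dotmul (q mu theta) x.

Section StochasticCost.
Variables (pi : nat -> vec -> Ctl) (x0 : vec).

Fixpoint traj (w : nat -> Theta) (k : nat) : vec :=
  match k with
  | 0 => x0
  | j.+1 => let x := traj w j in f x (pi j x) (w j)
  end.

Definition partial_cost N (w : nat -> Theta) : R :=
  \sum_(k < N) alpha ^+ k * g (traj w k) (pi k (traj w k)) (w k).

(* Only w 0, ..., w N.-1 matter in [partial_cost N w], so the default value of
   [nth] is irrelevant. *)
Definition sample_cost N (w : N.-tuple Theta) : R :=
  partial_cost N (nth point w).

Definition expected_cost N : \bar R := 'E_(iid P N)[@sample_cost N].

Definition stoch_cost : \bar R := limn expected_cost.

(* Minimization is over the sequences for which the expected cost makes sense.
   The measurability clauses hold for all sequences if, e.g., Theta is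
   countable and carries its discrete sigma-algebra. *)
Definition admissible_upto N : Prop :=
  (forall k, policy (pi k)) /\ measurable_fun setT (@sample_cost N).

Definition admissible : Prop := forall N, admissible_upto N.

End StochasticCost.

Definition Jstar_upto N (x0 : vec) : \bar R :=
  ereal_inf [set expected_cost pi x0 N | pi in [set pi | admissible_upto pi x0 N]].

Definition Jstar (x0 : vec) : \bar R :=
  ereal_inf [set stoch_cost pi x0 | pi in [set pi | admissible pi x0]].

Definition stoch_optimal (mu : vec -> Ctl) : Prop :=
  policy mu /\ forall x0, X x0 ->
    admissible (fun=> mu) x0 /\ stoch_cost (fun=> mu) x0 = Jstar x0.

Fixpoint det_traj (x0 : vec) (u : nat -> Ctl) (k : nat) : vec :=
  match k with
  | 0 => x0
  | j.+1 => mean_dyn (det_traj x0 u j) (u j)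
  end.

Definition det_cost (x0 : vec) (u : nat -> Ctl) : \bar R :=
  (\sum_(0 <= k <oo) (alpha ^+ k * mean_stage (det_traj x0 u k) (u k))%:E)%E.

Definition det_Jstar (x0 : vec) : \bar R :=
  ereal_inf [set det_cost x0 u |
    u in [set u : nat -> Ctl | forall k, U (det_traj x0 u k) (u k)]].

Definition feedback (mu : vec -> Ctl) (x0 : vec) (k : nat) : Ctl :=
  mu (iter k (fun x => mean_dyn x (mu x)) x0).

Definition det_optimal (mu : vec -> Ctl) : Prop :=
  policy mu /\ forall x0, X x0 -> det_cost x0 (feedback mu x0) = det_Jstar x0.

Definition Hval (c x : vec) (u : Ctl) : R :=
  Ex (fun theta => g x u theta + alpha * dotmul c (f x u theta)).

Definition is_min (A : set R) (m : R) : Prop := A m /\ lbound A m.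

Definition bellman_vec (c ch : vec) : Prop :=
  nonneg_mx ch /\
  forall x, X x -> is_min [set Hval c x u | u in U x] (dotmul ch x).

(* The vector is the unique one related to c by [bellman_vec] when the first
   clause of [closure_attainability] holds; 0 is a default otherwise. *)
Definition Ghat (c : vec) : vec := xget 0 [set ch | bellman_vec c ch].

Definition closure_attainability (M : set (vec -> Ctl)) : Prop :=
  [/\ forall c, nonneg_mx c -> exists! ch, bellman_vec c ch,
      {within nonneg_mx, continuous Ghat}
    & forall c, nonneg_mx c -> exists2 mu, M mu &
        forall x, X x -> U x (mu x) /\
          forall u, U x u -> Hval c x (mu x) <= Hval c x u].

Definition stabilizability (M : set (vec -> Ctl))
    (A : (vec -> Ctl) -> Theta -> 'M[R]_n) : Prop :=
  exists2 mu, M mu & stable (alpha *: Ex_mx (A mu)).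

Definition state_space_structure : Prop :=
  forall v : vec, nonneg_mx v -> exists x (s : R), [/\ X x, 0 <= s & s *: x = v].

Definition observability : Prop :=
  exists N, forall x0, X x0 -> x0 != 0 -> (0 < Jstar_upto N x0)%E.

End SemilinearProblem.

(* Main.v *)
(* For a policy mu in M the cost of a linear function c'x is again linear, namely
   H_mu(c)'x with H_mu(c) = E{q} + alpha E{A}'c, and by linearity of the
   expectation the stochastic and deterministic N-stage costs of mu both equal
   (H_mu^N 0)'x; hence the two problems agree on M. For arbitrary policies or
   control sequences both N-stage costs dominate (G^N 0)'x, by Tonelli in the
   stochastic case. The iterates G^N 0 increase, are bounded thanks to the
   stabilizing policy, and converge to a fixed point c of G; a policy attaining
   the minimum at c has cost at most c'x in both problems. Observability makes
   G^N 0 strictly positive for some N, from which c is the only fixed point. *)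
From HB Require Import structures.
From mathcomp Require Import all_boot all_order all_algebra.
From mathcomp Require Import complex.
From mathcomp Require Import all_classical all_reals all_analysis.
From mathcomp Require Import measurable_realfun.
Require Import Defs.

Set Implicit Arguments.
Unset Strict Implicit.
Unset Printing Implicit Defensive.

Import Order.TTheory GRing.Theory Num.Theory.
Import numFieldNormedType.Exports.

Local Open Scope classical_set_scope.
Local Open Scope ring_scope.

(** * The pairing [c'x] and its monotonicity on the nonnegative orthant *)

Section Dotmul.
Context {R : realType} {n : nat}.
Implicit Types c x : 'cV[R]_n.

Lemma dotmulE c x : dotmul c x = \sum_i c i 0 * x i 0.
Proof. by rewrite /dotmul mxE; apply: eq_bigr => i _; rewrite mxE. Qed.

Lemma dotmul0l x : dotmul 0 x = 0.
Proof. by rewrite dotmulE big1// => i _; rewrite mxE mul0r. Qed.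

Lemma dotmulDl c c' x : dotmul (c + c') x = dotmul c x + dotmul c' x.
Proof. by rewrite /dotmul linearD mulmxDl mxE. Qed.

Lemma dotmulZr a c x : dotmul c (a *: x) = a * dotmul c x.
Proof. by rewrite /dotmul -scalemxAr mxE. Qed.

Lemma dotmul_trmx (A : 'M[R]_n) c x : dotmul (A^T *m c) x = dotmul c (A *m x).
Proof. by rewrite /dotmul trmx_mul trmxK mulmxA. Qed.

Lemma dotmul_delta c i : dotmul c (delta_mx i 0) = c i 0.
Proof.
rewrite dotmulE (bigD1 i)//= mxE !eqxx mulr1 big1 ?addr0// => j ji.
by rewrite mxE (negPf ji) mulr0.
Qed.

Lemma le_dotmul c c' x : nonneg_mx x -> (forall i, c i 0 <= c' i 0) ->
  dotmul c x <= dotmul c' x.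
Proof.
by move=> x0 cc'; rewrite !dotmulE; apply: ler_sum => i _; rewrite ler_wpM2r.
Qed.

Lemma dotmul_ge0 c x : nonneg_mx c -> nonneg_mx x -> 0 <= dotmul c x.
Proof. by move=> c0 x0; rewrite dotmulE sumr_ge0// => i _; rewrite mulr_ge0. Qed.

Lemma delta_mx_nonneg i : nonneg_mx (delta_mx i 0 : 'cV[R]_n).
Proof. by move=> j k; rewrite mxE ler0n. Qed.

End Dotmul.

(** * Powers of stable matrices *)

Section StablePowers.
Context {R : realType}.
Local Notation C := (complex R).
Local Notation normc := ComplexField.Normc.normc.

(** Peeling off the first term bounds a partial sum [S] by [s 0 + a S + K], since one more
    nonnegative term only increases it; then solve for [S]. *)
Lemma geometric_sum_bound (s : nat -> R) (a K : R) :
  0 <= a < 1 -> (forall k, 0 <= s k) ->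
  (forall N, \sum_(k < N) s k.+1 <= a * (\sum_(k < N) s k) + K) ->
  forall N, \sum_(k < N) s k <= (s 0%N + K) / (1 - a).
Proof.
move=> /andP[a0 a1] s0 sK N.
rewrite ler_pdivlMr ?subr_gt0// mulrBr mulr1 lerBlDr.
apply: (@le_trans _ _ (\sum_(k < N.+1) s k)).
  by rewrite big_ord_recr/= lerDl.
by rewrite big_ord_recl/= -addrA lerD2l (le_trans (sK N))// addrC mulrC.
Qed.

(* If the sequence ((B - z) B^k v)_k is summable and |z| < 1, so is (B^k v)_k;
   by Cayley-Hamilton, applying B - z for all eigenvalues z kills v. *)
Lemma summable_pow_prod n (B : 'M[C]_n.+1) (zs : seq C) :
  (forall z, z \in zs -> `|z| < 1) -> forall v : 'cV[C]_n.+1,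
  horner_mx B (\prod_(z <- zs) ('X - z%:P)) *m v = 0 ->
  exists K : R, forall N i, \sum_(k < N) normc ((B ^+ k *m v) i 0) <= K.
Proof.
elim: zs => [|z zs IH] zlt v.
  rewrite big_nil rmorph1 mul1mx => ->; exists 0 => N i.
  by rewrite big1// => k _; rewrite mulmx0 mxE ComplexField.Normc.normc0.
have z1 : normc z < 1.
  have := zlt z (mem_head _ _).
  by rewrite normc_def ltcE/= => /andP[_]; case: (z).
(* Commute the factors so that [B - z] acts on [v] first: [w = (B - z) v] is killed by the remaining
   product. *)
rewrite big_cons mulrC rmorphM/= -mulmxA.
set w := _ *m v => /(IH _ w) [z' zs'|K HK]; first by apply: zlt; rewrite inE zs' orbT.
have stepE k i : (B ^+ k.+1 *m v) i 0 = z * (B ^+ k *m v) i 0 + (B ^+ k *m w) i 0.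
  have -> : B ^+ k *m w = B ^+ k.+1 *m v - z *: (B ^+ k *m v).
    rewrite /w rmorphB/= horner_mx_X horner_mx_C mulmxBl mulmxBr.
    by rewrite mul_scalar_mx -scalemxAr mulmxA exprSr.
  move: (B ^+ k.+1 *m v) (B ^+ k *m v) => a b.
  by rewrite !mxE addrCA subrr addr0.
have s0 i k : 0 <= normc ((B ^+ k *m v) i 0).
  by case: (_ i 0) => a b; exact: sqrtr_ge0.
(* Summing the coordinatewise bounds gives one bound for all [i]; each summand is nonnegative
   because it dominates an empty sum. *)
exists (\sum_i (normc ((B ^+ 0 *m v) i 0) + K) / (1 - normc z)) => N i.
have bnd j M : \sum_(k < M) normc ((B ^+ k *m v) j 0) <=
    (normc ((B ^+ 0 *m v) j 0) + K) / (1 - normc z).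
  apply: (geometric_sum_bound (s := fun k => normc ((B ^+ k *m v) j 0))) => [||M'].
  - by rewrite z1 andbT; case: (z) => a b; exact: sqrtr_ge0.
  - exact: s0.
  - rewrite (le_trans _ (lerD (lexx _) (HK M' j)))// mulr_sumr -big_split/=.
    apply: ler_sum => k _; rewrite stepE -ComplexField.Normc.normcM.
    exact: le_normcD.
rewrite (le_trans (bnd i N))// (bigD1 i)//= lerDl sumr_ge0// => j _.
by rewrite (le_trans _ (bnd j 0%N))// big_ord0.
Qed.

(** Over the complex numbers the characteristic polynomial splits into factors [X - z] with [z] an
    eigenvalue, so Cayley-Hamilton provides a product that kills every [v]. *)
Lemma stable_summable n (B : 'M[R]_n) (v : 'cV[R]_n) :
  stable B -> exists K : R, forall N i, \sum_(k < N) iter k (mulmx B) v i 0 <= K.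
Proof.
(* Polynomials in a matrix require positive dimension, so dimension 0 is treated apart. *)
case: n B v => [|n] B v sB; first by exists 0 => N [].
have BC := Cayley_Hamilton (map_mx (real_complex R) B).
have [zs pE] := closed_field_poly_normal (char_poly (map_mx (real_complex R) B)).
have zlt z : z \in zs -> `|z| < 1.
  move=> zzs; apply: sB; rewrite eigenvalue_root_char pE.
  by rewrite (monicP (char_poly_monic _)) scale1r root_prod_XsubC.
have [|K HK] := summable_pow_prod (B := map_mx (real_complex R) B) zlt
    (v := map_mx (real_complex R) v).
  move: BC; rewrite pE (monicP (char_poly_monic _)) scale1r => ->.
  by rewrite mul0mx.
exists K => N i; apply: le_trans (HK N i); apply: ler_sum => k _.
have -> : map_mx (real_complex R) B ^+ k *m map_mx (real_complex R) v =
    map_mx (real_complex R) (iter k (mulmx B) v).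
  elim: (k : nat) => [|m IH]; first by rewrite expr0 mul1mx.
  by rewrite exprS -mulmxA IH iterS map_mxM.
rewrite mxE /= expr0n/= addr0 sqrtr_sqr; exact: ler_norm.
Qed.

End StablePowers.

(** * Expectations and linear policies *)

Section Expectations.
Context {R : realType} {n : nat} {d : measure_display}.
Context {Theta : measurableType d} {Ctl : Type}.
Variable pb : problem R n Theta Ctl.
Local Notation P := (law pb).

Local Notation integrable F := (P.-integrable setT (EFin \o F)).

Lemma ExE (F : Theta -> R) : Ex pb F = \int[P]_t F t.
Proof. by rewrite /Ex unlock. Qed.

Lemma integrable_addR (F G : Theta -> R) :
  integrable F -> integrable G -> integrable (fun t => F t + G t).
Proof.
move=> iF iG; apply: eq_integrable (integrableD measurableT iF iG) => //.
Qed.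

Lemma integrable_scaleR a (F : Theta -> R) :
  integrable F -> integrable (fun t => a * F t).
Proof.
by move=> iF; apply: eq_integrable (integrableZl measurableT a iF) => //.
Qed.

Lemma integrable_sumR (I : Type) (s : seq I) (F : I -> Theta -> R) :
  (forall i, integrable (F i)) -> integrable (fun t => \sum_(i <- s) F i t).
Proof.
move=> iF; apply: eq_integrable (integrable_sum measurableT s (fun i _ => iF i)) => //.
by move=> t _ /=; rewrite sumEFin.
Qed.

Lemma ExD (F G : Theta -> R) : integrable F -> integrable G ->
  Ex pb (fun t => F t + G t) = Ex pb F + Ex pb G.
Proof. by move=> iF iG; rewrite !ExE RintegralD. Qed.

Lemma ExZ a (F : Theta -> R) : integrable F ->
  Ex pb (fun t => a * F t) = a * Ex pb F.
Proof. by move=> iF; rewrite !ExE RintegralZl. Qed.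

Lemma Ex_sum (I : Type) (s : seq I) (F : I -> Theta -> R) :
  (forall i, integrable (F i)) ->
  Ex pb (fun t => \sum_(i <- s) F i t) = \sum_(i <- s) Ex pb (F i).
Proof.
move=> iF; elim: s => [|i s IH].
  rewrite big_nil ExE; under eq_Rintegral do rewrite big_nil.
  by rewrite Rintegral_cst// mul0r.
rewrite big_cons -IH -ExD//; last exact: integrable_sumR.
by rewrite !ExE; apply: eq_Rintegral => t _; rewrite big_cons.
Qed.

Lemma Ex_ge0 (F : Theta -> R) : (forall t, 0 <= F t) -> 0 <= Ex pb F.
Proof. by move=> F0; rewrite ExE Rintegral_ge0. Qed.

End Expectations.

(** * The Bellman expression and linear policies in a well-posed problem *)

Section Model.
Context {R : realType} {n : nat} {d : measure_display}.
Context {Theta : measurableType d} {Ctl : Type}.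
Variable pb : problem R n Theta Ctl.
Local Notation P := (law pb).
Local Notation X := (state_space pb).
Local Notation U := (ctrl pb).
Local Notation alpha := (disc pb).
Local Notation integrable F := (P.-integrable setT (EFin \o F)).
Hypothesis Hpb : well_posed pb.

Lemma disc_gt0 : 0 < alpha. Proof. by have /andP[] := disc_in01 Hpb. Qed.

Lemma integrable_dotmul_dyn c x u : X x -> U x u ->
  integrable (fun t => dotmul c (dyn pb x u t)).
Proof.
move=> Xx Ux; apply: (@eq_integrable _ _ _ _ _ _ (EFin \o
    (fun t => \sum_i c i 0 * dyn pb x u t i 0))) => //.
  by move=> t _ /=; rewrite dotmulE.
apply: integrable_sumR => i; apply: integrable_scaleR.
exact: (dyn_integrable Hpb).
Qed.

Lemma Ex_dotmul_dyn c x u : X x -> U x u ->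
  Ex pb (fun t => dotmul c (dyn pb x u t)) = dotmul c (mean_dyn pb x u).
Proof.
move=> Xx Ux; rewrite dotmulE.
transitivity (Ex pb (fun t => \sum_i c i 0 * dyn pb x u t i 0)).
  by rewrite !ExE; apply: eq_Rintegral => t _; rewrite dotmulE.
rewrite Ex_sum => [|i]; last exact/integrable_scaleR/(dyn_integrable Hpb).
apply: eq_bigr => i _; rewrite mxE ExZ//; exact: (dyn_integrable Hpb).
Qed.

(** Linearity of the expectation: [f] and [g] enter only through their means, which is why the
    deterministic counterpart has the same Bellman mapping. *)
Lemma HvalE c x u : X x -> U x u ->
  Hval pb c x u = mean_stage pb x u + alpha * dotmul c (mean_dyn pb x u).
Proof.
move=> Xx Ux; rewrite /Hval ExD; last 2 first.
- exact: (stage_integrable Hpb).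
- exact/integrable_scaleR/integrable_dotmul_dyn.
by rewrite ExZ ?Ex_dotmul_dyn//; exact: integrable_dotmul_dyn.
Qed.

Section StateSpace.
Hypothesis Hstate : state_space_structure pb.

(** Every unit vector is a nonnegative multiple of a state, so testing on [X] sees each
    coordinate. *)
Lemma le_dotmul_state (c c' : 'cV[R]_n) :
  (forall x, X x -> dotmul c x <= dotmul c' x) -> forall i, c i 0 <= c' i 0.
Proof.
move=> cc' i; have [x [s [Xx s0 sx]]] := Hstate (delta_mx_nonneg i).
by rewrite -!dotmul_delta -sx !dotmulZr ler_wpM2l// cc'.
Qed.

Lemma eq_dotmul_state (c c' : 'cV[R]_n) :
  (forall x, X x -> dotmul c x = dotmul c' x) -> c = c'.
Proof.
move=> cc'; apply/matrixP => i j; rewrite (ord1 j); apply/eqP.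
by rewrite eq_le !le_dotmul_state// => x Xx; rewrite cc'.
Qed.

Section LinearPolicies.
Context {M : set ('cV[R]_n -> Ctl)} {A : ('cV[R]_n -> Ctl) -> Theta -> 'M[R]_n}
  {q : ('cV[R]_n -> Ctl) -> Theta -> 'cV[R]_n}.
Hypothesis HM : linear_policies pb M A q.
Variable mu : 'cV[R]_n -> Ctl.
Hypothesis Mmu : M mu.

Lemma linear_policy x : X x -> U x (mu x).
Proof. exact: (HM Mmu).1. Qed.

Lemma linear_dyn t x : X x -> dyn pb x (mu x) t = A mu t *m x.
Proof. by move=> Xx; have [_ /(_ t)[_ /(_ x Xx)[]]] := HM Mmu. Qed.

Lemma linear_stage t x : X x -> stage pb x (mu x) t = dotmul (q mu t) x.
Proof. by move=> Xx; have [_ /(_ t)[_ /(_ x Xx)[]]] := HM Mmu. Qed.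

(** With [s x = e_j], the entry is [s] times coordinate [i] of the state that follows [x], whose
    integrability is part of [well_posed]. *)
Lemma integrable_mx i j : integrable (fun t => A mu t i j).
Proof.
have [x [s [Xx s0 sx]]] := Hstate (delta_mx_nonneg j).
apply: (@eq_integrable _ _ _ _ _ _ (EFin \o
    (fun t => s * dyn pb x (mu x) t i 0))) => //.
  move=> t _ /=; rewrite linear_dyn//; congr (_%:E).
  transitivity ((A mu t *m (s *: x)) i 0); first by rewrite -scalemxAr [RHS]mxE.
  by rewrite sx -colE mxE.
apply: integrable_scaleR; apply: (dyn_integrable Hpb) => //.
exact: linear_policy.
Qed.

Lemma integrable_vec i : integrable (fun t => q mu t i 0).
Proof.
have [x [s [Xx s0 sx]]] := Hstate (delta_mx_nonneg i).
apply: (@eq_integrable _ _ _ _ _ _ (EFin \o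
    (fun t => s * stage pb x (mu x) t))) => //.
  by move=> t _ /=; rewrite linear_stage// -dotmulZr sx dotmul_delta.
apply: integrable_scaleR; apply: (stage_integrable Hpb) => //.
exact: linear_policy.
Qed.

(** Inherited from the nonnegative stage cost at states proportional to unit vectors. *)
Lemma linear_vec_ge0 t : nonneg_mx (q mu t).
Proof.
move=> i j; rewrite (ord1 j).
have [x [s [Xx s0 sx]]] := Hstate (delta_mx_nonneg i).
rewrite -dotmul_delta -sx dotmulZr mulr_ge0// -linear_stage//.
by apply: (stage_ge0 Hpb) => //; exact: linear_policy.
Qed.

Lemma mean_dyn_linear x : X x -> mean_dyn pb x (mu x) = Ex_mx pb (A mu) *m x.
Proof.
move=> Xx; apply/matrixP => i j; rewrite (ord1 j) !mxE.
transitivity (Ex pb (fun t => \sum_k x k 0 * A mu t i k)).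
  rewrite !ExE; apply: eq_Rintegral => t _; rewrite linear_dyn// mxE.
  by apply: eq_bigr => k _; rewrite mulrC.
rewrite Ex_sum => [|k]; last exact/integrable_scaleR/integrable_mx.
apply: eq_bigr => k _; rewrite ExZ; last exact: integrable_mx.
by rewrite mxE mulrC.
Qed.

Lemma mean_stage_linear x : X x ->
  mean_stage pb x (mu x) = dotmul (Ex_mx pb (q mu)) x.
Proof.
move=> Xx; rewrite dotmulE.
transitivity (Ex pb (fun t => \sum_k x k 0 * q mu t k 0)).
  rewrite /mean_stage !ExE; apply: eq_Rintegral => t _.
  by rewrite linear_stage// dotmulE; apply: eq_bigr => k _; rewrite mulrC.
rewrite Ex_sum => [|k]; last exact/integrable_scaleR/integrable_vec.
apply: eq_bigr => k _; rewrite ExZ; last exact: integrable_vec.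
by rewrite mxE mulrC.
Qed.

End LinearPolicies.
End StateSpace.
End Model.

Section PolicyOperator.
Context {R : realType} {n : nat} {d : measure_display}.
Context {Theta : measurableType d} {Ctl : Type}.
Variable pb : problem R n Theta Ctl.
Variables (A : ('cV[R]_n -> Ctl) -> Theta -> 'M[R]_n)
  (q : ('cV[R]_n -> Ctl) -> Theta -> 'cV[R]_n).

(** The map [H_mu]; the transpose appears because it acts on cost vectors, the dual side of the
    states. *)
Definition policy_op (mu : 'cV[R]_n -> Ctl) (c : 'cV[R]_n) : 'cV[R]_n :=
  Ex_mx pb (q mu) + (disc pb *: Ex_mx pb (A mu))^T *m c.

Context {M : set ('cV[R]_n -> Ctl)}.
Hypothesis Hpb : well_posed pb.
Hypothesis HM : linear_policies pb M A q.
Hypothesis Hstate : state_space_structure pb.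
Variable mu : 'cV[R]_n -> Ctl.
Hypothesis Mmu : M mu.
Local Notation X := (state_space pb).

Lemma dotmul_policy_op c x : dotmul (policy_op mu c) x =
  dotmul (Ex_mx pb (q mu)) x + disc pb * dotmul c (Ex_mx pb (A mu) *m x).
Proof. by rewrite dotmulDl dotmul_trmx -scalemxAl dotmulZr. Qed.

Lemma Hval_policy c x : X x -> Hval pb c x (mu x) = dotmul (policy_op mu c) x.
Proof.
move=> Xx; rewrite HvalE//; last exact: (linear_policy HM Mmu).
rewrite dotmul_policy_op (mean_stage_linear Hpb Hstate HM Mmu)//.
by rewrite (mean_dyn_linear Hpb Hstate HM Mmu).
Qed.

Lemma Ex_vec_ge0 : nonneg_mx (Ex_mx pb (q mu)).
Proof.
move=> i j; rewrite mxE Ex_ge0// => t.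
exact: (linear_vec_ge0 Hpb Hstate HM Mmu).
Qed.

Lemma Ex_matrix_ge0 : nonneg_mx (disc pb *: Ex_mx pb (A mu)).
Proof.
move=> i j; rewrite !mxE mulr_ge0 ?(ltW (disc_gt0 Hpb)) ?Ex_ge0// => t.
by have [_ /(_ t)[]] := HM Mmu.
Qed.

End PolicyOperator.

(** * Tonelli recursion for the expected cost *)

Section Recursion.
Context {R : realType} {n : nat} {d : measure_display}.
Context {Theta : measurableType d} {Ctl : Type}.
Variable pb : problem R n Theta Ctl.
Local Notation P := (law pb).
Local Notation X := (state_space pb).
Local Notation U := (ctrl pb).
Local Notation alpha := (disc pb).
Hypothesis Hpb : well_posed pb.
Implicit Types (pi : nat -> 'cV[R]_n -> Ctl) (x : 'cV[R]_n).

Definition tail_policy pi k := pi k.+1.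

(** [traj] recurses on the last stage, whereas dynamic programming must peel off the first one. *)
Lemma trajS pi x w k : traj pb pi x w k.+1 =
  traj pb (tail_policy pi) (dyn pb x (pi 0%N x) (w 0%N)) (fun j => w j.+1) k.
Proof. by elim: k => [|k IH] //; rewrite [LHS]/= -/(traj pb pi x w k.+1) IH. Qed.

Lemma partial_costS pi x N w : partial_cost pb pi x N.+1 w =
  stage pb x (pi 0%N x) (w 0%N) + alpha *
    partial_cost pb (tail_policy pi) (dyn pb x (pi 0%N x) (w 0%N)) N
      (fun j => w j.+1).
Proof.
rewrite /partial_cost big_ord_recl expr0 mul1r; congr (_ + _).
rewrite mulr_sumr; apply: eq_bigr => k _.
by rewrite mulrA -exprS -trajS.
Qed.

Lemma sample_cost_cons pi x N (t : Theta) (w : N.-tuple Theta) :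
  sample_cost pb pi x (tuple_cons (t, w)) = stage pb x (pi 0%N x) t +
    alpha * sample_cost pb (tail_policy pi) (dyn pb x (pi 0%N x) t) w.
Proof. exact: partial_costS. Qed.

Lemma traj_state pi x w k :
  (forall j, policy pb (pi j)) -> X x -> X (traj pb pi x w k).
Proof.
by move=> pol Xx; elim: k => [|k IH] //=; apply: (dyn_state Hpb) => //; exact: pol.
Qed.

Lemma sample_cost_ge0 pi x N (w : N.-tuple Theta) :
  (forall j, policy pb (pi j)) -> X x -> 0 <= sample_cost pb pi x w.
Proof.
move=> pol Xx; apply: sumr_ge0 => k _.
rewrite mulr_ge0 ?exprn_ge0 ?(ltW (disc_gt0 Hpb))//.
have Xk := traj_state (nth point w) k pol Xx.
by apply: (stage_ge0 Hpb) => //; exact: pol.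
Qed.

Lemma expected_cost_ge0 pi x N :
  (forall j, policy pb (pi j)) -> X x -> (0 <= expected_cost pb pi x N)%E.
Proof.
by move=> pol Xx; apply: expectation_ge0 => w; exact: sample_cost_ge0.
Qed.

Lemma expected_cost0 pi x : expected_cost pb pi x 0 = 0%E.
Proof.
rewrite /expected_cost unlock; under eq_integral do
  rewrite /sample_cost/= /partial_cost big_ord0.
by rewrite integral0.
Qed.

Section Step.
Variables (pi : nat -> 'cV[R]_n -> Ctl) (x : 'cV[R]_n) (N : nat).
Hypothesis Xx : X x.
Hypothesis adm : admissible_upto pb pi x N.+1.
Local Notation next t := (dyn pb x (pi 0%N x) t).

Let F (z : Theta * N.-tuple Theta) : \bar R :=
  (sample_cost pb pi x (tuple_cons z))%:E.

Lemma next_state t : X (next t).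
Proof. by apply: (dyn_state Hpb) => //; exact: adm.1. Qed.

Let mF : measurable_fun setT F.
Proof.
apply/measurable_EFinP; exact: (measurableT_comp adm.2 (@measurable_tuple_cons _ _ N)).
Qed.

Let F0 z : (0 <= F z)%E.
Proof. by rewrite lee_fin; apply: sample_cost_ge0 => //; exact: adm.1. Qed.

Lemma admissible_upto_tail t : admissible_upto pb (tail_policy pi) (next t) N.
Proof.
split; first by move=> k; exact: adm.1.
have := measurableT_comp adm.2 (measurableT_comp (@measurable_tuple_cons _ _ N)
  (pair1_measurable t)) => mt.
(* The tail cost is recovered from the section of the full cost at [t]: subtract the first stage
   cost, a constant in [w], and divide by [alpha > 0]. *)
rewrite (_ : @sample_cost _ _ _ _ _ _ _ _ _ = fun w => alpha^-1 *
   (sample_cost pb pi x (tuple_cons (t, w)) - stage pb x (pi 0%N x) t)).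
  by apply: measurable_funM => //; apply: measurable_funB.
apply/funext => w; rewrite sample_cost_cons addrC addKr mulKf//.
by rewrite gt_eqF// disc_gt0.
Qed.

Let stepF t : fubini_F (iid P N) F t = ((stage pb x (pi 0%N x) t)%:E +
   alpha%:E * expected_cost pb (tail_policy pi) (next t) N)%E.
Proof.
have [pol mt] := admissible_upto_tail t.
have Xt := next_state t.
rewrite /fubini_F /F.
under eq_integral do rewrite sample_cost_cons EFinD EFinM.
rewrite ge0_integralD//; last 3 first.
- by move=> w _; rewrite lee_fin (stage_ge0 Hpb)//; exact: adm.1.
- move=> w _; rewrite -EFinM lee_fin mulr_ge0 ?(ltW (disc_gt0 Hpb))//.
  exact: sample_cost_ge0.
- by apply: measurable_funeM; exact/measurable_EFinP.
rewrite integral_cst//; congr (_ + _)%E.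
  by rewrite -[RHS]mule1; congr (_ * _)%E; exact: (probability_setT (iid P N)).
rewrite ge0_integralZl//.
- by rewrite /expected_cost unlock.
- exact/measurable_EFinP.
- by move=> w _; rewrite lee_fin sample_cost_ge0.
- by rewrite lee_fin ltW// disc_gt0.
Qed.

(** The tail's initial state depends on the first draw, so measurability in [t] is not visible stage
    by stage; Tonelli supplies it for the inner integral of the full cost. *)
Lemma measurable_expected_cost_step :
  measurable_fun setT (fun t => (stage pb x (pi 0%N x) t)%:E +
   alpha%:E * expected_cost pb (tail_policy pi) (next t) N)%E.
Proof.
have := measurable_fun_fubini_tonelli_F (m2 := iid P N) F mF F0.
by apply: eq_measurable_fun => t _; rewrite stepF.
Qed.

(** [iid P N.+1] is the image of a product measure under [tuple_cons]: change variables, then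
    integrate out the last [N] draws by Tonelli. *)
Lemma expected_cost_step : expected_cost pb pi x N.+1 =
  (\int[P]_t ((stage pb x (pi 0%N x) t)%:E +
   alpha%:E * expected_cost pb (tail_policy pi) (next t) N))%E.
Proof.
rewrite /expected_cost unlock /= ge0_integral_distribution; last 2 first.
- by apply/measurable_EFinP; exact: adm.2.
- by move=> w; rewrite lee_fin; apply: sample_cost_ge0 => //; exact: adm.1.
rewrite (_ : (_ \o _) = F)// fubini_tonelli1//.
by apply: eq_integral => t _; rewrite stepF /expected_cost unlock.
Qed.

End Step.
End Recursion.

(** * N-stage costs *)

Section Values.
Context {R : realType} {n : nat} {d : measure_display}.
Context {Theta : measurableType d} {Ctl : Type}.
Variable pb : problem R n Theta Ctl.
Local Notation P := (law pb).
Local Notation X := (state_space pb).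
Local Notation U := (ctrl pb).
Local Notation alpha := (disc pb).
Hypothesis Hpb : well_posed pb.
Implicit Types (pi : nat -> 'cV[R]_n -> Ctl) (x : 'cV[R]_n).

Lemma integral_Ex (F : Theta -> R) : P.-integrable setT (EFin \o F) ->
  (\int[P]_t (F t)%:E)%E = (Ex pb F)%:E.
Proof.
by move=> iF; rewrite /Ex unlock fineK//; exact: integrable_fin_num.
Qed.

Lemma integrable_Hval c x u : X x -> U x u -> P.-integrable setT
  (EFin \o (fun t => stage pb x u t + alpha * dotmul c (dyn pb x u t))).
Proof.
move=> Xx Ux; apply: integrable_addR; first exact: (stage_integrable Hpb).
exact/integrable_scaleR/integrable_dotmul_dyn.
Qed.

(** The two sample costs live on different product spaces, so they are compared by induction through
    the first-stage recursion instead of pointwise. *)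
Lemma expected_cost_nondecreasing pi x N : X x ->
  admissible_upto pb pi x N -> admissible_upto pb pi x N.+1 ->
  (expected_cost pb pi x N <= expected_cost pb pi x N.+1)%E.
Proof.
elim: N pi x => [|N IH] pi x Xx adm admS.
  by rewrite expected_cost0 expected_cost_ge0//; exact: adm.1.
have a0 := ltW (disc_gt0 Hpb).
have pos t N' : (0 <= (stage pb x (pi 0%N x) t)%:E + alpha%:E *
    expected_cost pb (tail_policy pi) (dyn pb x (pi 0%N x) t) N')%E.
  rewrite adde_ge0//.
    by rewrite lee_fin (stage_ge0 Hpb)//; exact: adm.1.
  rewrite mule_ge0// expected_cost_ge0//; last exact: (next_state Hpb Xx adm).
  by move=> k; exact: adm.1.
rewrite (expected_cost_step Hpb Xx adm) (expected_cost_step Hpb Xx admS).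
apply: ge0_le_integral => //.
- exact: (measurable_expected_cost_step Hpb Xx adm).
- exact: (measurable_expected_cost_step Hpb Xx admS).
- move=> t _; rewrite leeD2l// lee_wpmul2l//; apply: IH.
  + exact: (next_state Hpb Xx adm).
  + exact: (admissible_upto_tail Hpb adm).
  + exact: (admissible_upto_tail Hpb admS).
Qed.

Section LowerBound.
Variable V : nat -> 'cV[R]_n.
Hypothesis V0 : V 0%N = 0.
Hypothesis V_ge0 : forall k, nonneg_mx (V k).
Hypothesis V_step : forall k x u, X x -> U x u ->
  dotmul (V k.+1) x <= Hval pb (V k) x u.

(** [V k] stands for [G^k 0]. The first stage is bounded by [V_step], and the induction hypothesis
    applies from each possible next state. *)
Lemma expected_cost_lower_bound pi x N : X x -> admissible_upto pb pi x N ->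
  ((dotmul (V N) x)%:E <= expected_cost pb pi x N)%E.
Proof.
elim: N pi x => [|N IH] pi x Xx adm; first by rewrite V0 dotmul0l expected_cost0.
have a0 := ltW (disc_gt0 Hpb).
have Ux : U x (pi 0%N x) by exact: adm.1.
rewrite (expected_cost_step Hpb Xx adm).
apply: (@le_trans _ _ (Hval pb (V N) x (pi 0%N x))%:E).
  by rewrite lee_fin V_step.
rewrite -integral_Ex; last exact: integrable_Hval.
apply: ge0_le_integral => //.
- move=> t _; rewrite lee_fin addr_ge0 ?(stage_ge0 Hpb)// mulr_ge0//.
  apply: dotmul_ge0 => //; apply: (state_nonneg Hpb).
  exact: (next_state Hpb Xx adm).
- exact: measurable_int (integrable_Hval _ Xx Ux).
- exact: (measurable_expected_cost_step Hpb Xx adm).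
- move=> t _; rewrite EFinD EFinM leeD2l// lee_wpmul2l//; apply: IH.
  + exact: (next_state Hpb Xx adm).
  + exact: (admissible_upto_tail Hpb adm).
Qed.

End LowerBound.

Lemma det_trajS x (u : nat -> Ctl) k : det_traj pb x u k.+1 =
  det_traj pb (mean_dyn pb x (u 0%N)) (fun j => u j.+1) k.
Proof. by elim: k => [|k IH] //; rewrite [LHS]/= -/(det_traj pb x u k.+1) IH. Qed.

Definition det_partial_cost x (u : nat -> Ctl) N : R :=
  \sum_(k < N) alpha ^+ k * mean_stage pb (det_traj pb x u k) (u k).

Lemma det_partial_costS x u N : det_partial_cost x u N.+1 =
  mean_stage pb x (u 0%N) + alpha *
    det_partial_cost (mean_dyn pb x (u 0%N)) (fun j => u j.+1) N.
Proof.
rewrite /det_partial_cost big_ord_recl expr0 mul1r; congr (_ + _).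
rewrite mulr_sumr; apply: eq_bigr => k _.
by rewrite mulrA -exprS -det_trajS.
Qed.

Lemma det_costE x u :
  det_cost pb x u = limn (fun N => (det_partial_cost x u N)%:E).
Proof.
rewrite /det_cost; congr (limn _); apply/funext => N.
by rewrite sumEFin big_mkord.
Qed.

Definition det_feasible x (u : nat -> Ctl) :=
  forall k, U (det_traj pb x u k) (u k).

Lemma det_feasible_tail x u : det_feasible x u ->
  det_feasible (mean_dyn pb x (u 0%N)) (fun j => u j.+1).
Proof. by move=> fu k; rewrite -det_trajS; exact: fu. Qed.

Lemma det_traj_state x u k : X x -> det_feasible x u -> X (det_traj pb x u k).
Proof.
move=> Xx fu; elim: k => [|k IH] //=; apply: (mean_dyn_state Hpb) => //.
Qed.

Lemma mean_stage_ge0 x u : X x -> U x u -> 0 <= mean_stage pb x u.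
Proof. by move=> Xx Ux; apply: Ex_ge0 => t; exact: (stage_ge0 Hpb). Qed.

Lemma det_partial_cost_nondecreasing x u : X x -> det_feasible x u ->
  {homo (det_partial_cost x u) : M N / (M <= N)%N >-> M <= N}.
Proof.
move=> Xx fu; apply/nondecreasing_seqP => N.
rewrite /det_partial_cost big_ord_recr/= lerDl mulr_ge0 ?exprn_ge0//.
  by rewrite ltW// disc_gt0.
apply: mean_stage_ge0; first exact: det_traj_state.
exact: fu.
Qed.

Lemma det_partial_cost_lower_bound (V : nat -> 'cV[R]_n) x u N :
  V 0%N = 0 ->
  (forall k x u, X x -> U x u -> dotmul (V k.+1) x <= Hval pb (V k) x u) ->
  X x -> det_feasible x u -> dotmul (V N) x <= det_partial_cost x u N.
Proof.
move=> V0 V_step; elim: N x u => [|N IH] x u Xx fu.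
  by rewrite V0 dotmul0l /det_partial_cost big_ord0.
have Ux : U x (u 0%N) := fu 0%N.
rewrite det_partial_costS (le_trans (V_step N x (u 0%N) Xx Ux))// HvalE//.
rewrite lerD2l ler_wpM2l ?(ltW (disc_gt0 Hpb))//; apply: IH.
  exact: (mean_dyn_state Hpb).
exact: det_feasible_tail.
Qed.

End Values.

(** * Costs of the policies in [M], stochastic and deterministic *)

Section LinearValues.
Context {R : realType} {n : nat} {d : measure_display}.
Context {Theta : measurableType d} {Ctl : Type}.
Variable pb : problem R n Theta Ctl.
Local Notation P := (law pb).
Local Notation X := (state_space pb).
Local Notation U := (ctrl pb).
Local Notation alpha := (disc pb).
Context {M : set ('cV[R]_n -> Ctl)} {A : ('cV[R]_n -> Ctl) -> Theta -> 'M[R]_n}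
  {q : ('cV[R]_n -> Ctl) -> Theta -> 'cV[R]_n}.
Hypothesis Hpb : well_posed pb.
Hypothesis HM : linear_policies pb M A q.
Hypothesis Hstate : state_space_structure pb.
Implicit Types (pi : nat -> 'cV[R]_n -> Ctl) (x : 'cV[R]_n).

(** Sequences that vary with the stage are included because [G^N 0] will be realized by such a
    sequence. *)
Fixpoint policy_value pi N : 'cV[R]_n :=
  if N is N'.+1 then policy_op pb A q (pi 0%N) (policy_value (tail_policy pi) N')
  else 0.

Lemma policy_value_stationary mu N :
  policy_value (fun=> mu) N = iter N (policy_op pb A q mu) 0.
Proof. by elim: N => // N IH; rewrite iterS -IH. Qed.

Lemma measurable_nth_tuple N k :
  measurable_fun setT (fun w : N.-tuple Theta => nth point w k).
Proof.
have [kN|Nk] := ltnP k N.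
  rewrite (_ : (fun _ => _) = (fun w : N.-tuple Theta => tnth w (Ordinal kN))).
    exact: measurable_tnth.
  by apply/funext => w; rewrite (tnth_nth point).
(* Past the length of the tuple, [nth] returns the constant default. *)
rewrite (_ : (fun _ => _) = cst point); first exact: measurable_cst.
by apply/funext => w; rewrite nth_default// size_tuple.
Qed.

Lemma measurable_int_real (F : Theta -> R) :
  P.-integrable setT (EFin \o F) -> measurable_fun setT F.
Proof. by move=> iF; apply/measurable_EFinP; exact: measurable_int iF. Qed.

Lemma measurable_traj pi x N k i : (forall k, M (pi k)) -> X x ->
  measurable_fun setT (fun w : N.-tuple Theta => traj pb pi x (nth point w) k i 0).
Proof.
move=> Mpi Xx; elim: k i => [|k IH] i; first exact: measurable_cst.
rewrite (_ : (fun _ => _) = (fun w : N.-tuple Theta => \sum_j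
   A (pi k) (nth point w k) i j * traj pb pi x (nth point w) k j 0)).
  apply: measurable_sum => j; apply: measurable_funM => //.
  apply: (measurableT_comp (f := fun t => A (pi k) t i j)).
    exact/measurable_int_real/(integrable_mx Hpb Hstate HM (Mpi k)).
  exact: measurable_nth_tuple.
apply/funext => w /=; rewrite (linear_dyn HM (Mpi k)) ?mxE//.
by apply: (traj_state Hpb) => // j; exact: (HM (Mpi j)).1.
Qed.

(** The sample cost is a polynomial in entries of [A] and [q] at the successive draws, all
    measurable; hence policies in [M] compete in [Jstar] and [Jstar_upto]. *)
Lemma linear_admissible pi x : (forall k, M (pi k)) -> X x ->
  admissible pb pi x.
Proof.
move=> Mpi Xx N; have pol k : policy pb (pi k) by exact: (HM (Mpi k)).1.
split=> //.
rewrite (_ : @sample_cost _ _ _ _ _ _ _ _ _ = (fun w => \sum_(k < N) alpha ^+ k *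
   \sum_i q (pi k) (nth point w k) i 0 * traj pb pi x (nth point w) k i 0)).
  apply: measurable_sum => k; apply: measurable_funM => //.
  apply: measurable_sum => i; apply: measurable_funM; last exact: measurable_traj.
  apply: (measurableT_comp (f := fun t => q (pi k) t i 0)).
    exact/measurable_int_real/(integrable_vec Hpb Hstate HM (Mpi k)).
  exact: measurable_nth_tuple.
apply/funext => w; apply: eq_bigr => k _.
rewrite (linear_stage HM (Mpi k)) ?dotmulE//; exact: (traj_state Hpb).
Qed.

Lemma expected_cost_linear pi x N : (forall k, M (pi k)) -> X x ->
  expected_cost pb pi x N = (dotmul (policy_value pi N) x)%:E.
Proof.
elim: N pi x => [|N IH] pi x Mpi Xx; first by rewrite expected_cost0 dotmul0l.
have adm := linear_admissible Mpi Xx N.+1.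
have Ux : U x (pi 0%N x) by exact: adm.1.
rewrite (expected_cost_step Hpb Xx adm) /= -(Hval_policy Hpb HM Hstate (Mpi 0%N))//.
rewrite -integral_Ex; last exact: integrable_Hval.
apply: eq_integral => t _; rewrite EFinD EFinM IH//; first by move=> k; exact: Mpi.
exact: (next_state Hpb Xx adm).
Qed.

Lemma det_feasible_feedback mu x : M mu -> X x ->
  det_feasible pb x (feedback pb mu x).
Proof.
move=> Mmu Xx k; have trajE j : det_traj pb x (feedback pb mu x) j =
    iter j (fun y => mean_dyn pb y (mu y)) x.
  by elim: j => // j IH; rewrite /= IH.
have Xj j : X (iter j (fun y => mean_dyn pb y (mu y)) x).
  elim: j => // j IH; rewrite iterS; apply: (mean_dyn_state Hpb) => //.
  exact: (linear_policy HM Mmu).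
by rewrite trajE; exact: (linear_policy HM Mmu).
Qed.

Lemma det_partial_cost_linear mu x N : M mu -> X x ->
  det_partial_cost pb x (feedback pb mu x) N =
  dotmul (iter N (policy_op pb A q mu) 0) x.
Proof.
move=> Mmu; elim: N x => [|N IH] x Xx.
  by rewrite /det_partial_cost big_ord0 dotmul0l.
have Ux := linear_policy HM Mmu Xx.
rewrite iterS -(Hval_policy Hpb HM Hstate Mmu)// HvalE// det_partial_costS.
rewrite -IH; last exact: (mean_dyn_state Hpb).
congr (_ + _ * det_partial_cost _ _ _ _); apply/funext => k.
by rewrite /feedback iterSr.
Qed.

(** The [N]-stage costs agree for every [N], so the limits agree, finite or not. *)
Lemma linear_cost_eq mu x : M mu -> X x ->
  stoch_cost pb (fun=> mu) x = det_cost pb x (feedback pb mu x).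
Proof.
move=> Mmu Xx; rewrite det_costE /stoch_cost; congr (limn _).
apply/funext => N; rewrite det_partial_cost_linear// expected_cost_linear//.
by rewrite policy_value_stationary.
Qed.

End LinearValues.

(** * Fixed point and optimality *)

Section Limits.
Context {R : realType}.

(** Matrix neighbourhoods contain entrywise boxes, and finitely many eventual conditions hold
    eventually together. *)
Lemma cvg_mx_coord m n (V : nat -> 'M[R]_(m, n)) (c : 'M[R]_(m, n)) :
  (forall i j, V k i j @[k --> \oo] --> c i j) -> V @ \oo --> c.
Proof.
move=> cV S [Q cQ sQS].
have : \forall k \near \oo, forall ij : 'I_m * 'I_n, Q ij.1 ij.2 (V k ij.1 ij.2).
  by apply: filter_forall => ij; exact: cV (cQ ij.1 ij.2).
by apply: filterS => k Qk; apply: sQS => i j; exact: (Qk (i, j)).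
Qed.

Lemma cvg_dotmul n (V : nat -> 'cV[R]_n) (c x : 'cV[R]_n) :
  (forall i, V k i 0 @[k --> \oo] --> c i 0) ->
  dotmul (V k) x @[k --> \oo] --> dotmul c x.
Proof.
move=> cV; rewrite dotmulE; under eq_fun do rewrite dotmulE.
apply: cvg_big => [|i _]; first exact: add_continuous.
by apply: cvgM => //; exact: cvg_cst.
Qed.

Lemma within_continuous_seq m n (S : set 'M[R]_(m, n))
    (G : 'M[R]_(m, n) -> 'M[R]_(m, n)) (V : nat -> 'M[R]_(m, n)) c :
  {within S, continuous G} -> S c -> (forall k, S (V k)) -> V @ \oo --> c ->
  (G \o V) @ \oo --> G c.
Proof.
move=> /subspace_continuousP cG Sc SV Vc Q /(cG c Sc) /Vc[N _ VQ].
by exists N => // k Nk; exact: (VQ k Nk (SV k)).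
Qed.

End Limits.

(** * Value iteration from 0, its limit, and the optimal costs *)

Section FixedPoint.
Context {R : realType} {n : nat} {d : measure_display}.
Context {Theta : measurableType d} {Ctl : Type}.
Variable pb : problem R n Theta Ctl.
Local Notation X := (state_space pb).
Local Notation U := (ctrl pb).
Local Notation alpha := (disc pb).
Context {M : set ('cV[R]_n -> Ctl)} {A : ('cV[R]_n -> Ctl) -> Theta -> 'M[R]_n}
  {q : ('cV[R]_n -> Ctl) -> Theta -> 'cV[R]_n}.
Hypothesis Hpb : well_posed pb.
Hypothesis HM : linear_policies pb M A q.
Hypothesis Hclosure : closure_attainability pb M.
Hypothesis Hstate : state_space_structure pb.
Implicit Types (mu : 'cV[R]_n -> Ctl) (c x : 'cV[R]_n).

Local Notation op := (policy_op pb A q).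
Local Notation G := (Ghat pb).
Local Notation B mu := (alpha *: Ex_mx pb (A mu)).

Lemma Ghat_spec c : nonneg_mx c -> bellman_vec pb c (G c).
Proof.
move=> c0; have [H _ _] := Hclosure; have [ch [Hch _]] := H _ c0.
exact: (@xgetPex _ 0 [set ch | bellman_vec pb c ch] (ex_intro _ ch Hch)).
Qed.

Lemma Ghat_ge0 c : nonneg_mx c -> nonneg_mx (G c).
Proof. by case/Ghat_spec. Qed.

Lemma Ghat_le_Hval c x u : nonneg_mx c -> X x -> U x u ->
  dotmul (G c) x <= Hval pb c x u.
Proof.
by move=> /Ghat_spec[_ H] Xx Ux; have [_] := H x Xx; apply; exists u.
Qed.

(** A policy attaining the minimum makes both linear functions agree on [X], which determines the
    vector. *)
Lemma Ghat_policy c : nonneg_mx c -> exists2 mu, M mu & op mu c = G c.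
Proof.
move=> c0; have [_ _ /(_ c c0)[mu Mmu mu_min]] := Hclosure.
exists mu => //; apply: (eq_dotmul_state Hstate) => x Xx.
rewrite -(Hval_policy Hpb HM Hstate Mmu)//; have [Ux xmin] := mu_min x Xx.
apply/eqP; rewrite eq_le Ghat_le_Hval// andbT.
by have [_ /(_ x Xx)[[u Uu <-] _]] := Ghat_spec c0; rewrite xmin.
Qed.

Lemma Ghat_le_policy mu c i : M mu -> nonneg_mx c -> G c i 0 <= op mu c i 0.
Proof.
move=> Mmu c0; apply: (le_dotmul_state Hstate) => x Xx.
rewrite -(Hval_policy Hpb HM Hstate Mmu)// Ghat_le_Hval//.
exact: (linear_policy HM Mmu).
Qed.

Lemma le_trmx_mul (N : 'M[R]_n) c c' : nonneg_mx N ->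
  (forall i, c i 0 <= c' i 0) -> forall i, (N^T *m c) i 0 <= (N^T *m c') i 0.
Proof.
by move=> N0 cc' i; rewrite !mxE; apply: ler_sum => j _; rewrite mxE ler_wpM2l.
Qed.

Lemma le_policy_op mu c c' : M mu -> (forall i, c i 0 <= c' i 0) ->
  forall i, op mu c i 0 <= op mu c' i 0.
Proof.
move=> Mmu cc' i; rewrite [leLHS]mxE [leRHS]mxE lerD2l le_trmx_mul//.
exact: (Ex_matrix_ge0 Hpb HM Mmu).
Qed.

(** Take [mu] attaining the minimum at [c'], the larger vector:
    [G c <= H_mu c <= H_mu c' = G c']. *)
Lemma le_Ghat c c' : nonneg_mx c -> nonneg_mx c' ->
  (forall i, c i 0 <= c' i 0) -> forall i, G c i 0 <= G c' i 0.
Proof.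
move=> c0 c'0 cc' i; have [mu Mmu <-] := Ghat_policy c'0.
by rewrite (le_trans (Ghat_le_policy _ Mmu c0))// le_policy_op.
Qed.

Definition value_iter k : 'cV[R]_n := iter k G 0.
Local Notation V := value_iter.

Lemma value_iter_ge0 k : nonneg_mx (V k).
Proof. by elim: k => [i j|k IH]; [rewrite mxE | exact: Ghat_ge0]. Qed.

Lemma value_iter_step k x u : X x -> U x u ->
  dotmul (V k.+1) x <= Hval pb (V k) x u.
Proof. by move=> Xx Uu; apply: Ghat_le_Hval => //; exact: value_iter_ge0. Qed.

Lemma value_iter_le_fixpoint c k : nonneg_mx c -> c = G c ->
  forall i, V k i 0 <= c i 0.
Proof.
move=> c0 cG; elim: k => [|k IH] i; first by rewrite mxE.
by rewrite cG le_Ghat//; exact: value_iter_ge0.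
Qed.

Lemma value_iter_le_policy mu k : M mu -> forall i, V k i 0 <= iter k (op mu) 0 i 0.
Proof.
move=> Mmu; elim: k => [|k IH] i; first by rewrite mxE.
apply: le_trans (Ghat_le_policy _ Mmu (value_iter_ge0 k)) _.
exact: le_policy_op.
Qed.

Lemma value_iter_nondecreasing i : nondecreasing_seq (fun k => V k i 0).
Proof.
apply/nondecreasing_seqP => k; elim: k i => [|k IH] i.
  by rewrite mxE value_iter_ge0.
by apply: le_Ghat IH _; exact: value_iter_ge0.
Qed.

(** Duality moves the powers of the transposed matrix onto the state, where [stable_summable]
    applies to [B mu] itself. *)
Lemma dotmul_iter_policy_op mu k x : dotmul (iter k (op mu) 0) x =
  \sum_(j < k) dotmul (Ex_mx pb (q mu)) (iter j (mulmx (B mu)) x).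
Proof.
elim: k x => [|k IH] x; first by rewrite dotmul0l big_ord0.
rewrite iterS dotmulDl dotmul_trmx IH big_ord_recl; congr (_ + _).
by apply: eq_bigr => j _; rewrite -iterSr.
Qed.

Lemma value_iter_bounded i : stabilizability pb M A ->
  has_ubound (range (fun k => V k i 0)).
Proof.
move=> [mu Mmu sB]; have [K HK] := stable_summable (delta_mx i 0) sB.
exists (\sum_l Ex_mx pb (q mu) l 0 * K) => _ [k _ <-].
apply: le_trans (value_iter_le_policy k Mmu i) _.
rewrite -dotmul_delta dotmul_iter_policy_op.
under eq_bigr do rewrite dotmulE.
rewrite exchange_big; apply: ler_sum => l _; rewrite -mulr_sumr ler_wpM2l//.
exact: (Ex_vec_ge0 Hpb HM Hstate Mmu).
Qed.

(** The supremum is a genuine one only once the iterates are bounded, which stabilizability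
    ensures. *)
Definition value_limit : 'cV[R]_n := \col_i sup (range (fun k => V k i 0)).
Local Notation c_ := value_limit.

Hypothesis Hstab : stabilizability pb M A.

Lemma cvg_value_iter i : V k i 0 @[k --> \oo] --> c_ i 0.
Proof.
rewrite mxE; apply: nondecreasing_cvgn; first exact: value_iter_nondecreasing.
exact: value_iter_bounded.
Qed.

Lemma value_iter_le_limit k i : V k i 0 <= c_ i 0.
Proof.
rewrite mxE; apply: sup_upper_bound; last by exists k.
by split; [exists (V 0 i 0), 0%N | exact: value_iter_bounded].
Qed.

Lemma value_limit_ge0 : nonneg_mx c_.
Proof.
move=> i j; rewrite (ord1 j); apply: le_trans (value_iter_le_limit 0 i).
by rewrite mxE.
Qed.

(** The shifted iterates converge to [c_] and, by continuity of [G] on the orthant, also to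
    [G c_]. *)
Lemma value_limit_fixpoint : c_ = G c_.
Proof.
have [_ cG _] := Hclosure.
have cV : V @ \oo --> c_.
  by apply: cvg_mx_coord => i j; rewrite (ord1 j); exact: cvg_value_iter.
have cGV := within_continuous_seq cG value_limit_ge0 value_iter_ge0 cV.
apply/matrixP => i j; rewrite (ord1 j).
have h1 : V k.+1 i 0 @[k --> \oo] --> c_ i 0.
  by have := @cvg_value_iter i; rewrite -cvg_shiftS.
have h2 : V k.+1 i 0 @[k --> \oo] --> G c_ i 0.
  exact: (cvg_comp _ _ cGV (@coord_continuous _ _ _ i 0 (G c_))).
exact: (cvg_unique _ h1 h2).
Qed.

(** Backward dynamic programming: put a policy attaining the minimum at [V N] in front of the
    sequence already found for [N] stages. *)
Lemma value_iter_policies N : exists2 pi : nat -> 'cV[R]_n -> Ctl,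
  (forall k, M (pi k)) & policy_value pb (A := A) (q := q) pi N = V N.
Proof.
elim: N => [|N [pi Mpi IH]].
  by have [mu Mmu _] := Hstab; exists (fun=> mu).
have [mu Mmu muG] := Ghat_policy (value_iter_ge0 N).
exists (fun k => if k is j.+1 then pi j else mu); first by case.
by rewrite -[RHS]muG -IH.
Qed.

Lemma Jstar_upto_le N x : X x -> (Jstar_upto pb N x <= (dotmul (V N) x)%:E)%E.
Proof.
move=> Xx; have [pi Mpi <-] := value_iter_policies N.
rewrite -(expected_cost_linear Hpb HM Hstate)//.
apply: ereal_inf_lbound; exists pi => //.
exact: (linear_admissible Hpb HM Hstate Mpi Xx N).
Qed.

(** A state proportional to a unit vector is nonzero, and [V N] dominates the [N]-stage optimal cost
    there. *)
Lemma value_iter_gt0 : observability pb -> exists N, forall i, 0 < V N i 0.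
Proof.
move=> [N obs]; exists N => i.
have [x [s [Xx s0 sx]]] := Hstate (delta_mx_nonneg i).
have e0 : (delta_mx i 0 : 'cV[R]_n) != 0.
  by apply/eqP => /matrixP/(_ i 0)/eqP; rewrite !mxE !eqxx oner_eq0.
have x0 : x != 0 by apply: contraNneq e0 => x0; rewrite -sx x0 scaler0.
have s_gt0 : 0 < s.
  rewrite lt_neqAle s0 andbT eq_sym.
  by apply: contraNneq e0 => s0'; rewrite -sx s0' scale0r.
rewrite -dotmul_delta -sx dotmulZr mulr_gt0// -lte_fin.
exact: lt_le_trans (obs x Xx x0) (Jstar_upto_le N Xx).
Qed.

(** Unrolling the affine equation [c = H_mu c] [N] times separates the [N]-stage cost from the
    terminal term. *)
Lemma policy_fixpoint_decomp mu c N : op mu c = c ->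
  c = iter N (op mu) 0 + iter N (mulmx (B mu)^T) c.
Proof.
move=> cE; elim: N => [|N IH]; first by rewrite add0r.
by rewrite !iterS -{1}cE /policy_op -addrA -mulmxDr -IH.
Qed.

Lemma le_iter_trmx mu N c c' : M mu -> (forall i, c i 0 <= c' i 0) ->
  forall i, iter N (mulmx (B mu)^T) c i 0 <= iter N (mulmx (B mu)^T) c' i 0.
Proof.
move=> Mmu cc'; elim: N => //= N IH i; apply: le_trmx_mul => //.
exact: (Ex_matrix_ge0 Hpb HM Mmu).
Qed.

(* Let h = op^N 0 > 0, so that B'^N c_ = c_ - h; the excess e = c - c_ satisfies
   e <= B'^N e, and at an index where e/c_ attains its maximum r this gives
   r c_ <= r (c_ - h), whence r <= 0. *)
Lemma Ghat_fixpoint_unique c : observability pb -> nonneg_mx c -> c = G c -> c = c_.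
Proof.
move=> /value_iter_gt0[N V_gt0] c0 cG.
have [mu Mmu] := Ghat_policy value_limit_ge0; rewrite -value_limit_fixpoint => muE.
have cle i : c_ i 0 <= c i 0.
  rewrite mxE; apply: ge_sup; first by exists (V 0 i 0), 0%N.
  by move=> _ [k _ <-]; exact: value_iter_le_fixpoint.
have c_gt0 i : 0 < c_ i 0 by exact: lt_le_trans (V_gt0 i) (value_iter_le_limit N i).
pose e := c - c_.
(* The right side is [H_mu c - H_mu c_], where [H_mu c_ = c_] and [H_mu c >= G c = c]. *)
have eB i : e i 0 <= ((B mu)^T *m e) i 0.
  have -> : (B mu)^T *m e = op mu c - op mu c_.
    by rewrite /policy_op opprD addrACA subrr add0r mulmxBr.
  rewrite muE [leLHS]mxE [leRHS]mxE lerD2r {1}cG; exact: Ghat_le_policy.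
have eBN k i : e i 0 <= iter k (mulmx (B mu)^T) e i 0.
  elim: k i => //= k IH i; apply: le_trans (eB i) _.
  by apply: le_trmx_mul => //; exact: (Ex_matrix_ge0 Hpb HM Mmu).
apply/matrixP => j j'; rewrite (ord1 j'); apply/eqP; rewrite eq_le cle andbT.
(* The index [j] under comparison also shows that the index set is nonempty. *)
pose i := [arg max_(i > j) (e i 0 / c_ i 0)]%O.
have rmax k : e k 0 / c_ k 0 <= e i 0 / c_ i 0.
  by rewrite /i; case: Order.TotalTheory.arg_maxP => // l _; exact.
set r := e i 0 / c_ i 0 in rmax.
have e_le k : e k 0 <= (r *: c_) k 0 by rewrite [leRHS]mxE -ler_pdivrMr.
have iterZ k : iter k (mulmx (B mu)^T) (r *: c_) = r *: iter k (mulmx (B mu)^T) c_.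
  by elim: k => //= k ->; rewrite -scalemxAr.
have := le_trans (eBN N i) (le_iter_trmx N Mmu e_le i).
rewrite iterZ [leRHS]mxE.
have /matrixP/(_ i 0) := policy_fixpoint_decomp N muE; rewrite [RHS]mxE => cE.
have -> : e i 0 = r * c_ i 0 by rewrite mulfVK// gt_eqF.
rewrite [in leLHS]cE mulrDr gerDr => rh.
(* At this point [r h_i <= 0], and [h_i >= V N i > 0]. *)
have r0 : r <= 0.
  by rewrite -(pmulr_lle0 r (lt_le_trans (V_gt0 i) (value_iter_le_policy N Mmu i))).
rewrite -subr_le0; have := e_le j; rewrite mxE [leRHS]mxE mxE => /le_trans; apply.
by rewrite mulr_le0_ge0// ltW.
Qed.

Lemma le_value_limit x (L : \bar R) :
  (forall k, ((dotmul (V k) x)%:E <= L)%E) -> ((dotmul c_ x)%:E <= L)%E.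
Proof.
move=> VL; have cVx : (dotmul (V k) x)%:E @[k --> \oo] --> (dotmul c_ x)%:E.
  by apply: cvg_EFin; [exact: nearW | exact: (cvg_dotmul (@cvg_value_iter))].
rewrite -(cvg_lim _ cVx)//; apply: lime_le; first by apply/cvg_ex; eexists; exact: cVx.
exact: nearW.
Qed.

Lemma det_partial_cost_le_cost x u N : X x -> det_feasible pb x u ->
  ((det_partial_cost pb x u N)%:E <= det_cost pb x u)%E.
Proof.
move=> Xx fu; rewrite det_costE.
have nd : nondecreasing_seq (fun N => (det_partial_cost pb x u N)%:E).
  by move=> k l kl; rewrite lee_fin; exact: (det_partial_cost_nondecreasing Hpb).
rewrite (cvg_lim _ (ereal_nondecreasing_cvgn nd))//.
by apply: ereal_sup_ubound; exists N.
Qed.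

Lemma value_limit_le_det_cost x u : X x -> det_feasible pb x u ->
  ((dotmul c_ x)%:E <= det_cost pb x u)%E.
Proof.
move=> Xx fu; apply: le_value_limit => k.
apply: le_trans (det_partial_cost_le_cost k Xx fu); rewrite lee_fin.
by apply: (det_partial_cost_lower_bound Hpb) => //; exact: value_iter_step.
Qed.

Lemma value_limit_le_stoch_cost x pi : X x -> admissible pb pi x ->
  ((dotmul c_ x)%:E <= stoch_cost pb pi x)%E.
Proof.
move=> Xx adm; apply: le_value_limit => k.
have nd : nondecreasing_seq (expected_cost pb pi x).
  by apply/nondecreasing_seqP => N; exact: (expected_cost_nondecreasing Hpb).
apply: (@le_trans _ _ (expected_cost pb pi x k)).
  apply: (expected_cost_lower_bound Hpb) => //; first exact: value_iter_ge0.
  exact: value_iter_step.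
rewrite /stoch_cost (cvg_lim _ (ereal_nondecreasing_cvgn nd))//.
by apply: ereal_sup_ubound; exists k.
Qed.

(** Monotonicity of [H_mu] from [0 <= c_] keeps its iterates below the fixed point [c_], bounding
    every partial cost; the lower bound holds for all feasible controls. *)
Lemma det_cost_fixpoint_policy mu x : M mu -> op mu c_ = c_ -> X x ->
  det_cost pb x (feedback pb mu x) = (dotmul c_ x)%:E.
Proof.
move=> Mmu muE Xx; have fu := det_feasible_feedback Hpb HM Mmu Xx.
apply/eqP; rewrite eq_le value_limit_le_det_cost// andbT.
have ole k i : iter k (op mu) 0 i 0 <= c_ i 0.
  elim: k i => [|k IH] i; first by rewrite mxE value_limit_ge0.
  by rewrite iterS -muE le_policy_op.
rewrite det_costE; apply: lime_le.
  apply: ereal_nondecreasing_is_cvgn => k l kl; rewrite lee_fin.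
  exact: (det_partial_cost_nondecreasing Hpb).
apply: nearW => k; rewrite lee_fin (det_partial_cost_linear Hpb HM Hstate)//.
by apply: le_dotmul => //; exact: (state_nonneg Hpb).
Qed.

Lemma det_JstarE x : X x -> det_Jstar pb x = (dotmul c_ x)%:E.
Proof.
move=> Xx; apply/eqP; rewrite eq_le; apply/andP; split; last first.
  by apply: le_ereal_inf_tmp => _ [u fu <-]; exact: value_limit_le_det_cost.
have [mu Mmu] := Ghat_policy value_limit_ge0; rewrite -value_limit_fixpoint => muE.
rewrite -(det_cost_fixpoint_policy Mmu muE Xx).
apply: ereal_inf_lbound; exists (feedback pb mu x) => //.
exact: (det_feasible_feedback Hpb HM Mmu Xx).
Qed.

Lemma JstarE x : X x -> Jstar pb x = (dotmul c_ x)%:E.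
Proof.
move=> Xx; apply/eqP; rewrite eq_le; apply/andP; split; last first.
  by apply: le_ereal_inf_tmp => _ [pi adm <-]; exact: value_limit_le_stoch_cost.
have [mu Mmu] := Ghat_policy value_limit_ge0; rewrite -value_limit_fixpoint => muE.
rewrite -(det_cost_fixpoint_policy Mmu muE Xx).
rewrite -(linear_cost_eq Hpb HM Hstate)//.
apply: ereal_inf_lbound; exists (fun=> mu) => //.
exact: (linear_admissible Hpb HM Hstate).
Qed.

(** Both the cost of [mu] and the optimal cost are the same in the two problems. *)
Lemma det_optimal_iff_stoch mu : M mu -> det_optimal pb mu <-> stoch_optimal pb mu.
Proof.
move=> Mmu; split => -[pol opt]; split=> // x Xx.
  split; first exact: (linear_admissible Hpb HM Hstate).
  by rewrite (linear_cost_eq Hpb HM Hstate)// opt// det_JstarE// JstarE.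
have [_] := opt x Xx.
by rewrite (linear_cost_eq Hpb HM Hstate)// det_JstarE// JstarE.
Qed.

Lemma det_optimal_exists : exists2 mu, M mu & det_optimal pb mu.
Proof.
have [mu Mmu] := Ghat_policy value_limit_ge0; rewrite -value_limit_fixpoint => muE.
exists mu => //; split; first exact: (HM Mmu).1.
by move=> x Xx; rewrite det_JstarE// (det_cost_fixpoint_policy Mmu).
Qed.

End FixedPoint.

Theorem proposition8 (R : realType) (n : nat) (d : measure_display)
    (Theta : measurableType d) (Ctl : Type) (pb : problem R n Theta Ctl)
    (M : set ('cV[R]_n -> Ctl))
    (A : ('cV[R]_n -> Ctl) -> Theta -> 'M[R]_n)
    (q : ('cV[R]_n -> Ctl) -> Theta -> 'cV[R]_n)
    (Hpb : well_posed pb)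
    (HM : linear_policies pb M A q)
    (Hclosure : closure_attainability pb M)
    (Hstab : stabilizability pb M A)
    (Hstate : state_space_structure pb)
    (Hobs : observability pb) :
  (exists c : 'cV[R]_n,
     [/\ nonneg_mx c,
         forall x, state_space pb x ->
           Jstar pb x = (dotmul c x)%:E /\ det_Jstar pb x = (dotmul c x)%:E,
         c = Ghat pb c
       & forall c' : 'cV[R]_n, nonneg_mx c' -> c' = Ghat pb c' -> c' = c])
  /\
  (forall mu, M mu -> (det_optimal pb mu <-> stoch_optimal pb mu))
  /\
  (exists2 mu, M mu & det_optimal pb mu /\ stoch_optimal pb mu).
Proof.
have cE := value_limit_fixpoint Hpb HM Hclosure Hstate Hstab.
split; last split.
- exists (value_limit pb); split => //.
  + exact: (value_limit_ge0 Hpb HM Hclosure Hstate Hstab).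
  + move=> x Xx; split; first exact: (JstarE Hpb HM Hclosure Hstate Hstab).
    exact: (det_JstarE Hpb HM Hclosure Hstate Hstab).
  + by move=> c' c'0; exact: (Ghat_fixpoint_unique Hpb HM Hclosure Hstate Hstab).
- by move=> mu; exact: (det_optimal_iff_stoch Hpb HM Hclosure Hstate Hstab).
- have [mu Mmu opt] := det_optimal_exists Hpb HM Hclosure Hstate Hstab.
  exists mu => //; split=> //.
  exact/(det_optimal_iff_stoch Hpb HM Hclosure Hstate Hstab Mmu).
Qed.
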